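(* For positive integers $n_1,\ldots,n_{d+1}$, $$F_{(n_1,\ldots,n_{d+1})} = \sum_{\alpha^{(1)}, \ldots, \alpha^{(d)}} m^{(n_{d+1})}_{\alpha^{(1)},\ldots,\alpha^{(d)}}\, M_{\alpha^{(1)}}(\mathbf{x}^{(1)}) \cdots M_{\alpha^{(d)}}(\mathbf{x}^{(d)}),$$ where the sum runs over compositions $\alpha^{(1)},\ldots,\alpha^{(d)}$ with $|\alpha^{(i)}|=|\alpha^{(j)}|$ for all $i,j$, and $m^{(n_{d+1})}_{\alpha^{(1)},\ldots,\alpha^{(d)}}$ is the number of packed matrices $A\in\mathcal{M}([n_1]\times\cdots\times[n_d],n_{d+1})$ with $s_\ell(A)=\alpha^{(\ell)}$ for all $\ell\in[d]$.
   Context: A $d$-dimensional partition is an array $\pi=(\pi_{\mathbf{i}})_{\mathbf{i}\in\mathbb{Z}_+^d}$ of nonnegative integers with finitely many nonzero entries, weakly decreasing in each coordinate; $D(\pi)=\{(\mathbf{i},i)\in\mathbb{Z}_+^{d+1}:1\le i\le\pi_{\mathbf{i}}\}$; $\mathcal{P}(n_1,\ldots,n_{d+1})$ is the set of those with $D(\pi)\subseteq[n_1]\times\cdots\times[n_{d+1}]$; $\mathrm{Cor}(\pi)=\{\mathbf{i}\in D(\pi):\mathbf{i}+\mathbf{e}_\ell\notin D(\pi)\ \forall\ell\in[d]\}$. With variables $\mathbf{x}^{(k)}=(x^{(k)}_1,\ldots,x^{(k)}_{n_k})$, $F_{(n_1,\ldots,n_{d+1})}=\sum_{\pi\in\mathcal{P}(n_1,\ldots,n_{d+1})}\prod_{(i_1,\ldots,i_{d+1})\in\mathrm{Cor}(\pi)}x^{(1)}_{i_1}\cdots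 x^{(d)}_{i_d}$. For an array $A=(a_{\mathbf{i}})$ of nonnegative integers indexed by $\mathbb{Z}_+^d$ with finitely many nonzero entries, let $G_{1,\ldots,1}(A)$ be the maximum of $\sum_{\mathbf{j}\in\Pi}a_{\mathbf{j}}$ over directed lattice paths $\Pi$ (steps $\mathbf{i}\to\mathbf{i}+\mathbf{e}_\ell$) starting at $(1,\ldots,1)$; $\mathcal{M}([n_1]\times\cdots\times[n_d],n_{d+1})$ is the set of such $A$ supported in $[n_1]\times\cdots\times[n_d]$ with $G_{1,\ldots,1}(A)\le n_{d+1}$. For $\ell\in[d]$ and $i\in[n_\ell]$, let $B^{(\ell)}_i$ be the sum of entries $a_{i_1,\ldots,i_d}$ with $i_\ell=i$, and $s_\ell(A)=(B^{(\ell)}_1,\ldots,B^{(\ell)}_{n_\ell})$; $A$ is packed if each $s_\ell(A)$ has no zero entries between positive entries; the equality $s_\ell(A)=\alpha^{(\ell)}$ is understood after deleting trailing zeros. For a composition $\alpha=(\alpha_1,\ldots,\alpha_k)\in\mathbb{Z}_+^k$, $M_\alpha(y_1,\ldots,y_n)=\sum_{i_1<\cdots<i_k}y_{i_1}^{\alpha_1}\cdots y_{i_k}^{\alpha_k}$ (zero if $k>n$), and $|\alpha|=\sum\alpha_i$. *)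

(* Defs.v *)
From HB Require Import structures.
From mathcomp Require Import all_boot all_order all_algebra finmap.
From mathcomp Require Import boolp classical_sets functions cardinality fsbigop.
From mathcomp Require Import monalg.

Set Implicit Arguments.
Unset Strict Implicit.
Unset Printing Implicit Defensive.

Import Order.TTheory GRing.Theory Num.Theory.

Local Open Scope classical_set_scope.
Local Open Scope ring_scope.

(* All coordinates are shifted down by one: the natural number i stands for
   the positive integer i + 1, so that idx d is Z_+^d, [n] is {i | i < n} and
   the point (1, ..., 1) is the zero function. *)
Definition idx (d : nat) : choiceType := {ffun 'I_d -> nat}.

Definition array (d : nat) : choiceType := {fsfun idx d -> nat with 0%N}.

Definition idx1 (d : nat) : idx d := [ffun=> 0%N].

Definition shift (d : nat) (i : idx d) (l : 'I_d) : idx d :=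
  [ffun k => (i k + (k == l))%N].

Definition in_box (d : nat) (n : 'I_d -> nat) (i : idx d) : Prop :=
  forall l, (i l < n l)%N.

Definition is_partition (d : nat) (pi : array d) : Prop :=
  forall (i : idx d) (l : 'I_d), (pi (shift i l) <= pi i)%N.

(* Z_+^(d+1) is represented as the product Z_+^d x Z_+. *)
Definition diagram (d : nat) (pi : array d) : {fset (idx d * nat)} :=
  [fset c | c in [seq (i, k) | i <- finsupp pi, k <- iota 0 (pi i)]]%fset.

Lemma in_diagram (d : nat) (pi : array d) (i : idx d) (k : nat) :
  ((i, k) \in diagram pi) = (k < pi i)%N.
Proof.
apply/idP/idP.
  by rewrite !inE => /allpairsPdep[j [m [_]]]; rewrite mem_iota => h [-> ->].
move=> ki; rewrite !inE; apply/allpairsPdep; exists i, k; split=> //.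
  by rewrite mem_finsupp -lt0n; case: (pi i) ki.
by rewrite mem_iota.
Qed.

Definition partitions (d : nat) (n : 'I_d -> nat) (N : nat) : set (array d) :=
  [set pi | is_partition pi /\
            forall c, c \in diagram pi -> in_box n c.1 /\ (c.2 < N)%N].

(* Only the first d of the d + 1 directions are tested. *)
Definition corners (d : nat) (pi : array d) : {fset (idx d * nat)} :=
  [fset c in diagram pi |
     [forall l : 'I_d, (shift c.1 l, c.2) \notin diagram pi]]%fset.

(* The polynomial ring over the integers in the variables x^(l)_i. *)
Definition polyring (d : nat) : comNzRingType :=
  {malg int[{cmonom ('I_d * nat)%type}]}.

Definition xvar (d : nat) (l : 'I_d) (i : nat) : polyring d :=
  << ucm (l, i) >>.

Definition Fpoly (d : nat) (n : 'I_d -> nat) (N : nat) : polyring d :=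
  \sum_(pi \in partitions n N)
    \prod_(c <- corners pi) \prod_(l < d) xvar l (c.1 l).

Definition step (d : nat) : rel (idx d) :=
  [rel i j | [exists l : 'I_d, j == shift i l]].

(* A path starting at (1, ..., 1) is idx1 d :: p with p as below. *)
Definition path_weights (d : nat) (A : array d) : set nat :=
  [set w | exists2 p : seq (idx d),
             path (@step d) (idx1 d) p & w = (\sum_(j <- idx1 d :: p) A j)%N].

Definition is_maximum (W : set nat) (g : nat) : Prop :=
  W g /\ forall w, W w -> (w <= g)%N.

(* The default value 0 is never used, see last_passageP. *)
Definition last_passage (d : nat) (A : array d) : nat :=
  xget 0%N [set g | is_maximum (path_weights A) g].

Definition arrays_le (d : nat) (n : 'I_d -> nat) (N : nat) : set (array d) :=
  [set A : array d | (forall i, A i != 0%N -> in_box n i) /\ (last_passage A <= N)%N].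

Definition slice_sum (d : nat) (A : array d) (l : 'I_d) (i : nat) : nat :=
  (\sum_(j <- finsupp A | (j : idx d) l == i) A j)%N.

Definition slice_sums (d : nat) (n : 'I_d -> nat) (A : array d) (l : 'I_d) :
    seq nat :=
  mkseq (slice_sum A l) (n l).

Definition no_internal_zero (s : seq nat) : Prop :=
  forall i j k, (i < j < k)%N -> (0 < nth 0 s i)%N -> (0 < nth 0 s k)%N ->
    (0 < nth 0 s j)%N.

Definition packed (d : nat) (n : 'I_d -> nat) (A : array d) : Prop :=
  forall l, no_internal_zero (slice_sums n A l).

Definition delete_trailing_zeros (s : seq nat) : seq nat :=
  rev (drop (find (predC1 0%N) (rev s)) (rev s)).

Definition is_composition (a : seq nat) : bool := all (ltn 0) a.

(* A family alpha^(1), ..., alpha^(d) of compositions of equal size; the empty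
   composition is allowed. *)
Definition composition_families (d : nat) : set {ffun 'I_d -> seq nat} :=
  [set alpha | (forall l, is_composition (alpha l)) /\
               forall k l, sumn (alpha k) = sumn (alpha l)].
Arguments composition_families : clear implicits.

Definition packed_arrays (d : nat) (n : 'I_d -> nat) (N : nat)
    (alpha : {ffun 'I_d -> seq nat}) : set (array d) :=
  [set A | [/\ arrays_le n N A, packed n A &
            forall l, delete_trailing_zeros (slice_sums n A l) = alpha l]].

Definition mcoef (d : nat) (n : 'I_d -> nat) (N : nat)
    (alpha : {ffun 'I_d -> seq nat}) : nat :=
  #|` fset_set (packed_arrays n N alpha)|%fset.

Definition monomial_qsym (R : comNzRingType) (a : seq nat) (n : nat)
    (y : nat -> R) : R :=
  \sum_(f : {ffun 'I_(size a) -> 'I_n} |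
          [forall p : 'I_(size a), forall q : 'I_(size a), (p < q)%N ==> (f p < f q)%N])
     \prod_(p < size a) y (f p) ^+ nth 0%N a p.

(* Well-definedness of the maximum, of the cardinals and of the finitely
   supported sums above. *)
Definition height (d : nat) (i : idx d) : nat := (\sum_(l < d) i l)%N.

Lemma height_shift (d : nat) (i : idx d) (l : 'I_d) : height (shift i l) = (height i).+1.
Proof.
rewrite /height (eq_bigr (fun k => i k + (k == l))%N); last first.
  by move=> k _; rewrite ffunE.
rewrite big_split /= (bigD1 l) //= [X in (_ + X)%N](bigD1 l) //= eqxx.
by rewrite [X in (1 + X)%N]big1 ?addn0 ?addn1// => k /negPf ->.
Qed.

Lemma step_path_uniq (d : nat) (i : idx d) (p : seq (idx d)) : path (@step d) i p -> uniq (i :: p).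
Proof.
move=> h; have : sorted ltn (map (@height d) (i :: p)).
  rewrite /= path_map; apply: sub_path h => {}i j /= /existsP[l /eqP ->].
  by rewrite height_shift.
by move/(sorted_uniq ltn_trans ltnn)/map_uniq.
Qed.

Lemma path_weight_bound (d : nat) (A : array d) (w : nat) : path_weights A w ->
  (w <= \sum_(j <- finsupp A) A j)%N.
Proof.
move=> [p /step_path_uniq u ->]; set s := _ :: _ in u *.
rewrite (bigID (mem (finsupp A))) /= addnC big1 ?add0n; last first.
  by move=> j; rewrite memNfinsupp => /eqP.
rewrite -big_filter; set t := filter _ _.
have ut : uniq t by rewrite filter_uniq.
have st : {subset t <= finsupp A} by move=> j; rewrite mem_filter => /andP[].
rewrite [leqRHS](bigID (mem t)) /=; apply: leq_trans (leq_addr _ _).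
rewrite -[leqRHS]big_filter (perm_big [seq x <- finsupp A | x \in t])//.
apply: uniq_perm => //; first by rewrite filter_uniq// fset_uniq.
by move=> x; rewrite [in RHS]mem_filter; case: (boolP (x \in t)) => // /st ->.
Qed.

Lemma last_passageP (d : nat) (A : array d) : is_maximum (path_weights A) (last_passage A).
Proof.
rewrite /last_passage; case: xgetP => [g _ //|H]; exfalso.
pose P g := `[< path_weights A g >].
have exP : exists g, P g.
  by exists (\sum_(j <- [:: idx1 d]) A j)%N; apply/asboolP; exists [::].
have ubP g : P g -> (g <= \sum_(j <- finsupp A) A j)%N.
  by move/asboolP/path_weight_bound.
case: (ex_maxnP exP ubP) => g /asboolP Pg gmax.
by apply: (H g); split=> // w Pw; apply: gmax; apply/asboolP.
Qed.

Lemma path_to (d : nat) (i : idx d) :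
  exists2 p, path (@step d) (idx1 d) p & last (idx1 d) p = i.
Proof.
move: {2}(height i) (erefl (height i)) => h.
elim: h i => [|h IH] i hi.
  exists [::] => //=; apply/ffunP => l; rewrite ffunE; apply/esym/eqP.
  by rewrite -leqn0 -hi /height (bigD1 l) //= leq_addr.
have [l il] : exists l, (0 < i l)%N.
  apply/not_existsP => H; move: hi; rewrite /height big1// => l _.
  by apply/eqP; rewrite -leqn0 leqNgt; apply/negP; exact: H.
pose j : idx d := [ffun k => (i k - (k == l))%N].
have ij : i = shift j l.
  by apply/ffunP => k; rewrite !ffunE; case: eqVneq => [->|_];
    rewrite ?subnK// subn0 addn0.
have [p pp lp] : exists2 p, path (@step d) (idx1 d) p & last (idx1 d) p = j.
  by apply: IH; apply: succn_inj; rewrite -hi ij height_shift.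
exists (rcons p i); last by rewrite last_rcons.
by rewrite rcons_path pp lp /=; apply/existsP; exists l; rewrite ij.
Qed.

Lemma entry_le_last_passage (d : nat) (A : array d) (i : idx d) :
  (A i <= last_passage A)%N.
Proof.
have [_ ub] := last_passageP A; have [p pp lp] := path_to i.
apply: leq_trans (ub _ (ex_intro2 _ _ p pp erefl)).
have : i \in idx1 d :: p by rewrite -lp mem_last.
by move=> ip; rewrite (big_rem i)//= leq_addr.
Qed.

Lemma finite_bounded_arrays (d : nat) (n : 'I_d -> nat) (N : nat) :
  finite_set [set A : array d | (forall i, A i != 0%N -> in_box n i) /\
                                forall i, (A i <= N)%N].
Proof.
set S := [set A : array d | _]; pose m := \max_(l < d) n l.
pose r (A : array d) : {ffun {ffun 'I_d -> 'I_m.+1} -> 'I_N.+1} :=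
  [ffun c : {ffun 'I_d -> 'I_m.+1} => inord (A [ffun l => val (c l)])].
have rinj A B : S A -> S B -> r A = r B -> A = B.
  move=> [sA bA] [sB bB] rAB; apply/fsfunP => i.
  have [ib|nib] := pselect (in_box n i); last first.
    by rewrite (eqP (contra_notT (sA i) nib)) (eqP (contra_notT (sB i) nib)).
  have im l : (i l < m.+1)%N.
    by rewrite ltnS (leq_trans (ltnW (ib l)))// /m leq_bigmax.
  have := congr1 (fun f : {ffun _ -> 'I_N.+1} =>
    val (f [ffun l => Ordinal (im l)])) rAB.
  rewrite /r !ffunE /=.
  have -> : [ffun l => val ([ffun l0 => Ordinal (im l0)] l)] = i.
    by apply/ffunP => l; rewrite !ffunE.
  by rewrite !inordK ?ltnS.
rewrite -(eq_finite_set (@inj_card_eq _ _ S r _)); first exact: finite_finset.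
by move=> A B; rewrite !inE; exact: rinj.
Qed.

Lemma finite_arrays_le (d : nat) (n : 'I_d -> nat) (N : nat) :
  finite_set (arrays_le n N).
Proof.
apply: sub_finite_set (finite_bounded_arrays n N) => A [sA gA]; split=> // i.
exact: leq_trans (entry_le_last_passage A i) gA.
Qed.

Lemma finite_partitions (d : nat) (n : 'I_d -> nat) (N : nat) :
  finite_set (partitions n N).
Proof.
apply: sub_finite_set (finite_bounded_arrays n N) => A [_ sA]; split=> i.
  by rewrite -lt0n -in_diagram => /sA[].
case E : (A i) => [//|k].
by have /sA[] : (i, k) \in diagram A by rewrite in_diagram E.
Qed.

Lemma finite_packed_arrays (d : nat) (n : 'I_d -> nat) (N : nat)
    (alpha : {ffun 'I_d -> seq nat}) : finite_set (packed_arrays n N alpha).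
Proof. by apply: sub_finite_set (finite_arrays_le n N) => A []. Qed.

Lemma finite_mcoef_support (d : nat) (n : 'I_d -> nat) (N : nat) :
  finite_set [set alpha | mcoef n N alpha != 0%N].
Proof.
pose s (A : array d) :=
  [ffun l : 'I_d => delete_trailing_zeros (slice_sums n A l)].
apply: sub_finite_set (finite_image s (finite_arrays_le n N)) => alpha /=.
rewrite /mcoef cardfs_eq0 => /fset0Pn[A].
rewrite in_fset_set; last exact: finite_packed_arrays.
rewrite inE => -[MA _ sA]; exists A => //.
by apply/ffunP => l; rewrite ffunE.
Qed.

(* Main.v *)
(* A partition pi is determined by the array A of its increments
   A_i = pi_i - max_l pi_(i+e_l): conversely pi_i is the last passage time of A
   from i, and A_i is the number of corners of pi above i. Hence F is the sum
   over A in M([n_1] x ... x [n_d], n_(d+1)) of the monomials with exponents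
   s_l(A) in the variables x^(l).

   Last passage times are maxima of sums over chains of the product order, so
   they do not change when zero slices are inserted or deleted. Thus the number
   of arrays A with s_l(A) = b^(l) for all l depends only on the nonzero entries
   alpha^(l) of b^(l), and equals the number of packed ones. As M_alpha is the
   sum of the monomials y^b over the b with nonzero entries alpha, summing over
   the families b gives the expansion. *)

Require Import Defs.
From HB Require Import structures.
From mathcomp Require Import all_boot all_order all_algebra finmap.
From mathcomp Require Import boolp classical_sets functions cardinality fsbigop.
From mathcomp Require Import monalg.

Set Implicit Arguments.
Unset Strict Implicit.
Unset Printing Implicit Defensive.

Import Order.TTheory GRing.Theory Num.Theory.

Local Open Scope classical_set_scope.
Local Open Scope ring_scope.

(** * Boxes as finite sets *)

(** The cube whose side is the largest [n l] is a finite type of functions into one ordinal; the box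
    is cut out of it. *)
Definition box (d : nat) (n : 'I_d -> nat) : {fset idx d} :=
  [fset i in [seq ([ffun l => val (c l)] : idx d) |
                c : {ffun 'I_d -> 'I_(\max_l n l)} <- enum predT] |
     [forall l, (i l < n l)%N]]%fset.

Lemma in_boxE (d : nat) (n : 'I_d -> nat) (i : idx d) :
  (i \in box n) = [forall l, (i l < n l)%N].
Proof.
rewrite !inE; apply: andb_idl => /forallP h.
have hm l : (i l < \max_l n l)%N by rewrite (leq_trans (h l))// leq_bigmax.
apply/mapP; exists [ffun l => Ordinal (hm l)]; first by rewrite mem_enum.
by apply/ffunP => l; rewrite !ffunE.
Qed.

Lemma in_boxP (d : nat) (n : 'I_d -> nat) (i : idx d) :
  reflect (in_box n i) (i \in box n).
Proof. by rewrite in_boxE; exact: forallP. Qed.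

Definition box_array (d : nat) (n : 'I_d -> nat) (f : idx d -> nat) : array d :=
  [fsfun i in box n => f i].

Lemma box_arrayE (d : nat) (n : 'I_d -> nat) (f : idx d -> nat) (i : idx d) :
  box_array n f i = if i \in box n then f i else 0%N.
Proof. by rewrite fsfunE. Qed.

Lemma big_finsupp (R : Type) (idx0 : R) (op : Monoid.com_law idx0) (d : nat)
    (A : array d) (s : seq (idx d)) (P : pred (idx d)) (F : idx d -> R) :
  uniq s -> {subset finsupp A <= s} -> (forall i, A i = 0%N -> F i = idx0) ->
  \big[op/idx0]_(i <- finsupp A | P i) F i = \big[op/idx0]_(i <- s | P i) F i.
Proof.
move=> us sA F0; rewrite [RHS](bigID (mem (finsupp A))) /= [X in op _ X]big1.
  rewrite Monoid.mulm1 -big_filter -[RHS]big_filter; apply: perm_big.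
  apply: uniq_perm; rewrite ?filter_uniq ?fset_uniq// => i.
  rewrite !mem_filter andbAC; case: (P i) => //=.
  by case: (boolP (i \in finsupp A)) => [/sA ->|_]; rewrite ?andbF.
by move=> i /andP[_]; rewrite memNfinsupp => /eqP/F0.
Qed.

(** * Partitions, increments and passage times *)

(* The maximum over an empty family of directions ([d = 0]) is [0]. *)
Definition max_shift (d : nat) (pi : array d) (i : idx d) : nat :=
  \max_(l < d) pi (shift i l).

Definition increments (d : nat) (pi : array d) : array d :=
  [fsfun i in finsupp pi => (pi i - max_shift pi i)%N].

Lemma incrementsE (d : nat) (pi : array d) (i : idx d) :
  increments pi i = (pi i - max_shift pi i)%N.
Proof.
rewrite fsfunE; case: ifP => // /negbT.
by rewrite memNfinsupp => /eqP ->; rewrite sub0n.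
Qed.

(** Recursion for last passage times: a best path from [i] collects [A i] and goes on from a best
    shift of [i]. *)
Definition passage_eq (d : nat) (A pi : array d) : Prop :=
  forall i, pi i = (A i + max_shift pi i)%N.

Lemma passage_eq_increments (d : nat) (pi : array d) :
  is_partition pi -> passage_eq (increments pi) pi.
Proof.
by move=> ppi i; rewrite incrementsE subnK//; apply/bigmax_leqP => l _; exact: ppi.
Qed.

Lemma passage_eq_partition (d : nat) (A pi : array d) :
  passage_eq A pi -> is_partition pi.
Proof.
move=> e i l; rewrite [leqRHS]e; apply: leq_trans (leq_addl _ _).
exact: (leq_bigmax (F := fun l => pi (shift i l))).
Qed.

Lemma increments_passage_eq (d : nat) (A pi : array d) :
  passage_eq A pi -> increments pi = A.
Proof. by move=> e; apply/fsfunP => i; rewrite incrementsE e addnK. Qed.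

Lemma height_bound (d : nat) (A : array d) :
  exists h, forall i : idx d, (h <= height i)%N -> A i = 0%N.
Proof.
exists (\max_(i <- finsupp A) height i).+1 => i hi; apply/eqP.
rewrite -memNfinsupp; apply: contraTN hi => iA.
by rewrite -ltnNge ltnS; apply: leq_bigmax_seq.
Qed.

(** Downward induction: each shift raises the height by one, and finitely supported arrays vanish at
    large heights, which gives the base case. *)
Lemma height_ind (d h : nat) (P : idx d -> Prop) :
  (forall i, (h <= height i)%N -> P i) ->
  (forall i, (forall l, P (shift i l)) -> P i) -> forall i, P i.
Proof.
move=> Pbig Pshift i; have [m] := ubnP (h - height i).
elim: m i => // m IH i; rewrite ltnS => hi.
have [/Pbig//|ih] := leqP h (height i).
apply: Pshift => l; apply: IH; rewrite height_shift.
by rewrite (leq_trans _ hi)// subnS prednK ?subn_gt0.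
Qed.

Lemma passage_eq_inj (d : nat) (A pi pi' : array d) :
  passage_eq A pi -> passage_eq A pi' -> pi = pi'.
Proof.
move=> e e'; apply/fsfunP.
have [h H] := height_bound pi; have [h' H'] := height_bound pi'.
apply: (@height_ind _ (maxn h h')) => i.
  by rewrite geq_max => /andP[/H -> /H' ->].
move=> IH; rewrite e e'; congr (_ + _)%N.
by apply: eq_bigr => l _; exact: IH.
Qed.

Lemma in_box_shift (d : nat) (n : 'I_d -> nat) (i : idx d) (l : 'I_d) :
  in_box n (shift i l) -> in_box n i.
Proof.
by move=> h k; apply: leq_ltn_trans (h k); rewrite ffunE leq_addr.
Qed.

(** The fuel bounds the number of points on a path, which makes the recursion along shifts
    structural. *)
Fixpoint passage_fuel (d : nat) (A : array d) (k : nat) (i : idx d) : nat :=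
  if k is k'.+1 then (A i + \max_(l < d) passage_fuel A k' (shift i l))%N
  else 0%N.

Lemma passage_fuel0 (d : nat) (n : 'I_d -> nat) (A : array d) k i :
  (forall i, A i != 0%N -> in_box n i) -> ~ in_box n i ->
  passage_fuel A k i = 0%N.
Proof.
move=> sA; elim: k i => //= k IH i ni.
rewrite (eqP (contra_notT (sA i) ni)) add0n; apply: big1 => l _.
by apply: IH => /in_box_shift.
Qed.

Lemma passage_eq_exists (d : nat) (n : 'I_d -> nat) (A : array d) :
  (forall i, A i != 0%N -> in_box n i) ->
  exists2 pi, passage_eq A pi & forall i, pi i != 0%N -> in_box n i.
Proof.
move=> sA; pose h := (\sum_l n l).+1.
pose pi := box_array n (fun i => passage_fuel A (h - height i) i).
have piE i : pi i = passage_fuel A (h - height i) i.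
  by rewrite box_arrayE; case: in_boxP => // /(passage_fuel0 (h - height i) sA) ->.
exists pi => [i|i]; last by rewrite box_arrayE; case: in_boxP.
have [ih|ih] := ltnP (height i) h.
  rewrite piE; case E : (h - height i)%N => [|k].
    by move/eqP: E; rewrite subn_eq0 leqNgt ih.
  congr (_ + _)%N; apply: eq_bigr => l _.
  by rewrite piE height_shift subnS E.
have ni : ~ in_box n i.
  move=> ib; move: ih; rewrite ltnNge leq_sum// => l _.
  exact: ltnW.
have pi0 j : ~ in_box n j -> pi j = 0%N by rewrite box_arrayE; case: in_boxP.
rewrite pi0// (eqP (contra_notT (sA i) ni)) /max_shift big1// => l _.
by apply: pi0 => /in_box_shift.
Qed.

Lemma path_weight_le_passage (d : nat) (A pi : array d) (i : idx d) p :
  passage_eq A pi -> path (@step d) i p ->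
  (\sum_(j <- i :: p) A j <= pi i)%N.
Proof.
move=> e; elim: p i => [|j p IH] i /=.
  by rewrite big_seq1 e leq_addr.
case/andP => /existsP[l /eqP ->] /IH h.
rewrite big_cons e leq_add2l (leq_trans h)//.
exact: (leq_bigmax (F := fun l => pi (shift i l))).
Qed.

(** Following at each point a shift that attains the maximum gives an optimal path; it may stop
    where [pi] vanishes. *)
Lemma passage_path_exists (d : nat) (A pi : array d) (i : idx d) :
  passage_eq A pi ->
  exists2 p, path (@step d) i p & pi i = (\sum_(j <- i :: p) A j)%N.
Proof.
move=> e; have [h H] := height_bound pi.
move: i; apply: (@height_ind _ h) => [i hi|i IH].
  exists [::] => //; rewrite big_seq1 H//.
  by have := e i; rewrite (H _ hi) => /esym/eqP; rewrite addn_eq0 => /andP[/eqP].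
(* For [d = 0] there is no shift to follow and the one-point path is optimal. *)
have [d0|d0] := posnP d.
  exists [::] => //; rewrite big_seq1 e /max_shift big1 ?addn0// => -[m mlt] _.
  by exfalso; move: mlt; rewrite d0.
have [|l ml] := @bigop.eq_bigmax 'I_d (fun l => pi (shift i l)).
  by rewrite card_ord.
have [p pp wp] := IH l; exists (shift i l :: p).
  by rewrite /= pp andbT; apply/existsP; exists l.
by rewrite big_cons e /max_shift ml wp.
Qed.

Lemma last_passageE (d : nat) (A pi : array d) :
  passage_eq A pi -> last_passage A = pi (idx1 d).
Proof.
move=> e; have [[p pp wp] ub] := last_passageP A; apply/eqP; rewrite eqn_leq.
apply/andP; split; first by rewrite wp path_weight_le_passage.
by have [q pq ->] := passage_path_exists (idx1 d) e; apply: ub; exists q.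
Qed.

Lemma partition_le_origin (d : nat) (pi : array d) (i : idx d) :
  is_partition pi -> (pi i <= pi (idx1 d))%N.
Proof.
move=> ppi; have [p + <-] := path_to i.
elim/last_ind: p => //= p j IH; rewrite rcons_path last_rcons.
case/andP => /IH h /existsP[l /eqP ->]; exact: leq_trans (ppi _ _) h.
Qed.

(** The form that matches [arrays_le]: a partition is largest at the origin, so one bound there
    controls all levels. *)
Lemma partitionsP (d : nat) (n : 'I_d -> nat) (N : nat) (pi : array d) :
  partitions n N pi <->
  [/\ is_partition pi, forall i, pi i != 0%N -> in_box n i &
      (pi (idx1 d) <= N)%N].
Proof.
split=> [[ppi H]|[ppi H hN]].
  split=> // [i|]; first by rewrite -lt0n -in_diagram => /H[].
  case E : (pi (idx1 d)) => [//|k].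
  by have /H[] : (idx1 d, k) \in diagram pi by rewrite in_diagram E.
split=> // -[i k]; rewrite in_diagram /= => ki; split.
  by apply: H; rewrite -lt0n (leq_ltn_trans _ ki).
exact: leq_trans ki (leq_trans (partition_le_origin i ppi) hN).
Qed.

(** The inverse map sends an array to its passage times, whose value at the origin is
    [last_passage]. *)
Lemma increments_bij (d : nat) (n : 'I_d -> nat) (N : nat) :
  set_bij (partitions n N) (arrays_le n N) (@increments d).
Proof.
split.
- move=> pi /partitionsP[ppi H hN]; split=> [i|].
    rewrite incrementsE => h; apply: H; apply: contraNneq h => ->.
    by rewrite sub0n.
  by rewrite (last_passageE (passage_eq_increments ppi)).
- move=> pi pi'; rewrite !inE => /partitionsP[ppi _ _] /partitionsP[ppi' _ _] E.
  apply: passage_eq_inj (passage_eq_increments ppi) _.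
  by rewrite E; exact: passage_eq_increments.
- move=> A [sA gA]; have [pi e spi] := passage_eq_exists sA.
  exists pi; last exact: increments_passage_eq.
  apply/partitionsP; split=> //; first exact: passage_eq_partition e.
  by rewrite -(last_passageE e).
Qed.

(** * From corner monomials to slice monomials *)

(** The corners over a fixed [i] thus form an interval of levels, of length [increments pi i]. *)
Lemma in_corners (d : nat) (pi : array d) (i : idx d) (k : nat) :
  ((i, k) \in corners pi) = (max_shift pi i <= k < pi i)%N.
Proof.
rewrite -in_diagram andbC in_fset inE /=; congr (_ && _).
apply/forallP/bigmax_leqP => h l; first by rewrite leqNgt -in_diagram.
by rewrite in_diagram -leqNgt; exact: h.
Qed.

Lemma prod_corners (R : comNzRingType) (d : nat) (pi : array d)
    (F : idx d -> R) :
  \prod_(c <- corners pi) F c.1 =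
  \prod_(i <- finsupp (increments pi)) F i ^+ increments pi i.
Proof.
rewrite (@big_finsupp _ _ _ _ _ (finsupp pi)) ?fset_uniq//; first last.
- by move=> i ->.
- move=> i; rewrite !mem_finsupp incrementsE; apply: contraNneq => ->.
  by rewrite sub0n.
transitivity (\prod_(c <- [seq (i, k) | i <- finsupp pi,
                 k <- index_iota (max_shift pi i) (pi i)]) F c.1).
  apply: perm_big; apply: uniq_perm; first exact: fset_uniq.
    apply: allpairs_uniq_dep => [|i _|]; rewrite ?fset_uniq ?iota_uniq//.
    by move=> [i k] [j m] _ _ /= [-> ->].
  move=> [i k]; rewrite in_corners -mem_index_iota.
  apply/idP/allpairsPdep => [ik|[j [m [_ ? [-> ->]]]]//]; exists i, k; split=> //.
  move: ik; rewrite mem_index_iota => /andP[_ ki].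
  by rewrite mem_finsupp -lt0n (leq_ltn_trans _ ki).
rewrite big_allpairs_dep; apply: eq_bigr => i _ /=.
by rewrite big_const_nat iter_mulr_1 incrementsE.
Qed.

Definition slice_monomial (R : comNzRingType) (y : nat -> R) (b : seq nat) : R :=
  \prod_(j < size b) y j ^+ nth 0%N b j.

(** Grouping the points by their [l]-th coordinate adds the exponents up to slice sums; the box
    condition keeps that coordinate below [n l]. *)
Lemma prod_slices (R : comNzRingType) (d : nat) (n : 'I_d -> nat) (A : array d)
    (l : 'I_d) (y : nat -> R) :
  (forall i, A i != 0%N -> in_box n i) ->
  \prod_(i <- finsupp A) y (i l) ^+ A i = slice_monomial y (slice_sums n A l).
Proof.
move=> sA; rewrite /slice_monomial size_mkseq.
under [RHS]eq_bigr => j _ do rewrite nth_mkseq// -prodrXr big_mkcond.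
rewrite exchange_big /= big_seq [RHS]big_seq; apply: eq_bigr => i.
rewrite mem_finsupp => /sA/(_ l) il; rewrite (bigD1 (Ordinal il))//= eqxx.
rewrite big1 ?mulr1// => j; rewrite eq_sym -val_eqE /= => /negPf ->//.
Qed.

Definition slice_weight (d : nat) (beta : {ffun 'I_d -> seq nat}) : polyring d :=
  \prod_(l < d) slice_monomial (xvar l) (beta l).

Definition slice_family (d : nat) (n : 'I_d -> nat) (A : array d) :
    {ffun 'I_d -> seq nat} := [ffun l => slice_sums n A l].

Lemma Fpoly_arrays (d : nat) (n : 'I_d -> nat) (N : nat) :
  Fpoly n N = \sum_(A \in arrays_le n N) slice_weight (slice_family n A).
Proof.
rewrite /Fpoly [RHS](reindex_fsbig _ _ _ _ (increments_bij n N)).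
apply: eq_fsbigr => pi; rewrite inE => ppi.
have [sA _] : arrays_le n N (increments pi).
  by have [sub _ _] := increments_bij n N; exact: sub.
rewrite (prod_corners pi (fun i => \prod_(l < d) xvar l (i l))).
under eq_bigr => i _ do rewrite -prodrXl.
rewrite exchange_big; apply: eq_bigr => l _.
by rewrite ffunE -prod_slices.
Qed.

(** * Last passage times as maxima over chains *)

(** Strict product order. Unlike unit steps, comparability survives the insertion or deletion of
    zero slices. *)
Definition idx_lt (d : nat) : rel (idx d) :=
  [rel i j : idx d | [forall l, (i l <= j l)%N] && (i != j)].

Lemma idx_lt_trans (d : nat) : transitive (@idx_lt d).
Proof.
move=> j i k /andP[/forallP ij nij] /andP[/forallP jk _]; apply/andP; split.
  by apply/forallP => l; exact: leq_trans (ij l) (jk l).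
apply: contraNneq nij => ik; apply/eqP/ffunP => l; apply/eqP.
by rewrite eqn_leq ij ik jk.
Qed.

Lemma step_idx_lt (d : nat) : subrel (@step d) (@idx_lt d).
Proof.
move=> i j /existsP[l /eqP ->]; apply/andP; split.
  by apply/forallP => k; rewrite ffunE leq_addr.
apply/eqP => /(congr1 (@height d)); rewrite height_shift => /eqP.
by rewrite eq_sym eqn_leq ltnn.
Qed.

Lemma path_between (d : nat) (i j : idx d) : (forall l, (i l <= j l)%N) ->
  exists2 p, path (@step d) i p & last i p = j.
Proof.
move=> ij; have [p pp lp] := path_to [ffun l => (j l - i l)%N].
pose t (k : idx d) : idx d := [ffun l => (i l + k l)%N].
have t1 : t (idx1 d) = i by apply/ffunP => l; rewrite !ffunE addn0.
exists (map t p); last first.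
  by rewrite -[in LHS]t1 last_map lp; apply/ffunP => l; rewrite !ffunE subnKC.
rewrite -t1 path_map; apply: sub_path pp => k m /= /existsP[l /eqP ->].
by apply/existsP; exists l; apply/eqP/ffunP => q; rewrite !ffunE addnA.
Qed.

Lemma chain_sub_path (d : nat) (x : idx d) s : path (@idx_lt d) x s ->
  exists2 p, path (@step d) x p & subseq s p.
Proof.
elim: s x => [|y s IH] x /=; first by exists [::].
case/andP => /andP[/forallP xy nxy] /IH[p pp sp].
(* As [x] and [y] differ, the path between them is nonempty; it ends in [y], where the path for the
   rest of the chain is attached. *)
have [q] := path_between xy; case/lastP: q => [|q z].
  by move=> _ /= E; rewrite E eqxx in nxy.
rewrite last_rcons => pq zy; rewrite zy in pq.
exists (rcons q y ++ p); first by rewrite cat_path pq last_rcons.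
rewrite cat_rcons -[y :: s]cat0s; apply: cat_subseq; first exact: sub0seq.
by rewrite /= eqxx.
Qed.

(** The chain is a subsequence of some lattice path from the origin, and the entries are
    nonnegative. *)
Lemma chain_weight_le (d : nat) (A : array d) s : sorted (@idx_lt d) s ->
  (\sum_(j <- s) A j <= last_passage A)%N.
Proof.
case: s => [|x s] /=; first by rewrite big_nil.
move=> /chain_sub_path[p pp sp]; have [q pq lq] := path_to x.
have [_ ub] := last_passageP A.
apply: leq_trans (ub _ (ex_intro2 _ _ (q ++ p) _ erefl)); last first.
  by rewrite cat_path pq lq.
have /subseqP[m _ ->] : subseq (x :: s) (idx1 d :: (q ++ p)).
  rewrite -cat_cons (lastI (idx1 d)) lq cat_rcons -[x :: s]cat0s.
  by apply: cat_subseq; rewrite ?sub0seq//= eqxx.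
move: (idx1 d :: _) => t; elim: t m => [|a t IH] [|[] m] //=;
  rewrite ?big_nil// big_cons; first by rewrite big_cons leq_add2l.
exact: leq_trans (IH m) (leq_addl _ _).
Qed.

(** Dropping the zero entries of an optimal path leaves a chain of the same weight. Only chains
    inside the support need testing, and there the maps [move_idx] below are monotone. *)
Lemma last_passage_le_chain (d : nat) (A : array d) (N : nat) :
  (forall s, sorted (@idx_lt d) s -> (forall i, i \in s -> A i != 0%N) ->
     (\sum_(j <- s) A j <= N)%N) -> (last_passage A <= N)%N.
Proof.
move=> H; have [[p pp ->] _] := last_passageP A.
have sp : sorted (@idx_lt d) (idx1 d :: p) by exact: sub_path (@step_idx_lt d) _ _ pp.
rewrite (bigID (fun i => A i != 0%N)) /= [X in (_ + X)%N]big1 ?addn0; last first.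
  by move=> i; rewrite negbK => /eqP.
rewrite -big_filter; apply: H => [|i].
  by apply: subseq_sorted (filter_subseq _ _) sp; exact: idx_lt_trans.
by rewrite mem_filter => /andP[].
Qed.

(** * Positions of the nonzero entries of a sequence *)

Definition nonzeros (s : seq nat) : seq nat := [seq x <- s | x != 0%N].

Definition positions (s : seq nat) : seq nat :=
  [seq j <- iota 0 (size s) | nth 0%N s j != 0%N].

Lemma mem_positions (s : seq nat) (j : nat) :
  (j \in positions s) = (nth 0%N s j != 0%N).
Proof.
rewrite mem_filter mem_iota /= add0n; apply: andb_idr.
by apply: contraNT; rewrite -leqNgt => h; rewrite nth_default.
Qed.

Lemma positions_lt_size (s : seq nat) (j : nat) :
  j \in positions s -> (j < size s)%N.
Proof. by rewrite mem_filter mem_iota => /andP[]. Qed.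

Lemma map_positions (s : seq nat) : map (nth 0%N s) (positions s) = nonzeros s.
Proof.
by rewrite /positions /nonzeros -[in RHS](mkseq_nth 0%N s) /mkseq filter_map.
Qed.

Lemma positions_sorted (s : seq nat) : sorted ltn (positions s).
Proof. by apply: sorted_filter; [exact: ltn_trans|exact: iota_ltn_sorted]. Qed.

Lemma positions_uniq (s : seq nat) : uniq (positions s).
Proof. by rewrite filter_uniq// iota_uniq. Qed.

Lemma size_positions (s : seq nat) : size (positions s) = size (nonzeros s).
Proof. by rewrite -map_positions size_map. Qed.

(** Sends the position of the r-th nonzero entry of [s] to that of the r-th nonzero entry of [t];
    meaningful only for [j] in [positions s]. *)
Definition reposition (s t : seq nat) (j : nat) : nat :=
  nth 0%N (positions t) (index j (positions s)).

Section Reposition.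
Variables s t : seq nat.
Hypothesis st : nonzeros s = nonzeros t.

Let size_pos : size (positions s) = size (positions t).
Proof. by rewrite !size_positions st. Qed.

Lemma reposition_in j : j \in positions s -> reposition s t j \in positions t.
Proof. by move=> js; rewrite mem_nth// -size_pos index_mem. Qed.

Lemma reposition_nth j :
  j \in positions s -> nth 0%N t (reposition s t j) = nth 0%N s j.
Proof.
move=> js; have ij : (index j (positions s) < size (positions s))%N.
  by rewrite index_mem.
rewrite /reposition -(nth_map 0%N 0%N (nth 0%N t)) -?size_pos//.
by rewrite map_positions -st -map_positions (nth_map 0%N)// nth_index.
Qed.

Lemma repositionK j : j \in positions s -> reposition t s (reposition s t j) = j.
Proof.
move=> js; rewrite /reposition index_uniq ?positions_uniq ?nth_index//.
by rewrite -size_pos index_mem.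
Qed.

(** Both lists of positions increase, so comparing positions amounts to comparing their indices. *)
Lemma reposition_le i j : i \in positions s -> j \in positions s ->
  (i <= j)%N -> (reposition s t i <= reposition s t j)%N.
Proof.
move=> is_ js; rewrite leq_eqVlt => /orP[/eqP -> //|ij].
have [h|h] := leqP (index j (positions s)) (index i (positions s)).
  have := sorted_leq_nth leq_trans leqnn 0%N (sub_sorted ltnW (positions_sorted s))
    (index j (positions s)) (index i (positions s)).
  rewrite !inE !index_mem js is_ => /(_ isT isT h).
  by rewrite !nth_index// leqNgt ij.
apply: ltnW; apply: (sorted_ltn_nth ltn_trans) h; first exact: positions_sorted.
  by rewrite inE -size_pos index_mem.
by rewrite inE -size_pos index_mem.
Qed.

End Reposition.

(** * Packed arrays as arrays with prescribed slice sums *)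

Lemma delete_trailing_zerosE (s : seq nat) :
  exists k, s = delete_trailing_zeros s ++ nseq k 0%N.
Proof.
rewrite /delete_trailing_zeros; set f := find _ _.
exists (size (take f (rev s))); rewrite -rev_nseq.
suff <- : take f (rev s) = nseq (size (take f (rev s))) 0%N.
  by rewrite -rev_cat cat_take_drop revK.
apply/all_pred1P/(all_nthP 0%N) => i; rewrite size_take_min leq_min => /andP[fi _].
by rewrite nth_take//= -[_ == _]negbK; apply/negbT; exact: before_find fi.
Qed.

Lemma delete_trailing_zeros_cat (a : seq nat) (k : nat) : is_composition a ->
  delete_trailing_zeros (a ++ nseq k 0%N) = a.
Proof.
move=> ca; rewrite /delete_trailing_zeros rev_cat rev_nseq.
elim: k => //=; case/lastP: a ca => [|a x] //.
rewrite /is_composition all_rcons => /andP[/= x0 _].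
by rewrite rev_rcons /= -lt0n x0 drop0 rev_cons revK.
Qed.

Lemma no_internal_zero_cat (a : seq nat) (k : nat) : is_composition a ->
  no_internal_zero (a ++ nseq k 0%N).
Proof.
move=> /allP ca i j m /andP[_ jm] _; rewrite !nth_cat.
case: (ltnP m) => [ma _|am]; last by rewrite nth_nseq; case: ifP.
by rewrite (ltn_trans jm ma); apply: ca; rewrite mem_nth// (ltn_trans jm ma).
Qed.

Lemma slice_sum_neq0 (d : nat) (A : array d) (l : 'I_d) (i : idx d) :
  A i != 0%N -> slice_sum A l (i l) != 0%N.
Proof.
move=> Ai; rewrite /slice_sum (big_rem i)/= ?mem_finsupp// eqxx.
by rewrite addn_eq0 negb_and Ai.
Qed.

(** Here the zeros among the slice sums may stand anywhere. *)
Definition arrays_with (d : nat) (n : 'I_d -> nat) (N : nat)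
    (b : {ffun 'I_d -> seq nat}) : set (array d) :=
  [set A | arrays_le n N A /\ slice_family n A = b].

Lemma finite_arrays_with (d : nat) (n : 'I_d -> nat) (N : nat)
    (b : {ffun 'I_d -> seq nat}) : finite_set (arrays_with n N b).
Proof. by apply: sub_finite_set (finite_arrays_le n N) => A []. Qed.

(** If [alpha l] is longer than [n l], truncated subtraction adds nothing, and its length alone
    keeps it from being a list of slice sums. *)
Definition pad (d : nat) (n : 'I_d -> nat) (alpha : {ffun 'I_d -> seq nat}) :
    {ffun 'I_d -> seq nat} :=
  [ffun l => alpha l ++ nseq (n l - size (alpha l)) 0%N].

(** Deleting trailing zeros only undoes the padding, whose amount is forced by the length [n l]; a
    padded composition has no internal zero, so packedness is automatic. *)
Lemma packed_arraysE (d : nat) (n : 'I_d -> nat) (N : nat)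
    (alpha : {ffun 'I_d -> seq nat}) :
  (forall l, is_composition (alpha l)) ->
  packed_arrays n N alpha = arrays_with n N (pad n alpha).
Proof.
move=> ca; apply/seteqP; split=> [A [MA _ sA]|A [MA sA]].
  split=> //; apply/ffunP => l; rewrite !ffunE.
  have [k E] := delete_trailing_zerosE (slice_sums n A l).
  rewrite sA in E; rewrite E; congr (_ ++ nseq _ _).
  have := congr1 size E; rewrite size_mkseq size_cat size_nseq => ->.
  by rewrite addKn.
have {}sA l : slice_sums n A l = alpha l ++ nseq (n l - size (alpha l)) 0%N.
  by have := congr1 (fun f : {ffun 'I_d -> seq nat} => f l) sA; rewrite !ffunE.
split=> // [l|l]; rewrite sA; first exact: no_internal_zero_cat.
exact: delete_trailing_zeros_cat.
Qed.

Lemma nonzeros_cat_nseq0 (a : seq nat) (k : nat) : is_composition a ->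
  nonzeros (a ++ nseq k 0%N) = a.
Proof.
move=> ca; rewrite /nonzeros filter_cat filter_nseq /= cats0.
by apply/all_filterP; apply: sub_all ca => x /=; rewrite lt0n.
Qed.

(** * Moving arrays between families with the same nonzero entries *)

Definition on_positions (d : nat) (b : {ffun 'I_d -> seq nat}) (i : idx d) : bool :=
  [forall l, i l \in positions (b l)].

Definition move_idx (d : nat) (b c : {ffun 'I_d -> seq nat}) (i : idx d) : idx d :=
  [ffun l => reposition (b l) (c l) (i l)].

(* The entries of [A], lying on the nonzero slices [b], are pulled back to the
   nonzero slices [c] along the order isomorphisms of the positions. *)
Definition move_array (d : nat) (n : 'I_d -> nat) (b c : {ffun 'I_d -> seq nat})
    (A : array d) : array d :=
  box_array n (fun i => if on_positions c i then A (move_idx c b i) else 0%N).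

Section MoveArray.
Variables (d : nat) (n : 'I_d -> nat) (N : nat).
Implicit Types (b c : {ffun 'I_d -> seq nat}) (A : array d) (i : idx d).

Lemma move_idx_on b c i : (forall l, nonzeros (b l) = nonzeros (c l)) ->
  on_positions b i -> on_positions c (move_idx b c i).
Proof.
move=> bc /forallP ib; apply/forallP => l; rewrite ffunE.
exact: reposition_in.
Qed.

Lemma move_idxK b c i : (forall l, nonzeros (b l) = nonzeros (c l)) ->
  on_positions b i -> move_idx c b (move_idx b c i) = i.
Proof.
move=> bc /forallP ib; apply/ffunP => l; rewrite !ffunE.
exact: repositionK.
Qed.

Lemma move_idx_lt b c i j : (forall l, nonzeros (b l) = nonzeros (c l)) ->
  on_positions b i -> on_positions b j -> idx_lt i j ->
  idx_lt (move_idx b c i) (move_idx b c j).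
Proof.
move=> bc ib jb /andP[/forallP ij nij]; apply/andP; split.
  apply/forallP => l; rewrite !ffunE; apply: reposition_le => //.
    exact: (forallP ib).
  exact: (forallP jb).
by apply: contraNneq nij => /(congr1 (move_idx c b)); rewrite !move_idxK// => ->.
Qed.

(** A nonzero entry makes every slice through it nonzero. *)
Lemma arrays_with_on b A i : arrays_with n N b A -> A i != 0%N -> on_positions b i.
Proof.
move=> [[sA _] <-] Ai; apply/forallP => l; rewrite mem_positions ffunE.
by rewrite nth_mkseq ?slice_sum_neq0//; exact: sA.
Qed.

(** Points on the positions of [c] already lie in the box, so the restriction to the box loses
    nothing. *)
Lemma move_arrayE b c A i : (forall l, size (c l) = n l) ->
  move_array n b c A i = if on_positions c i then A (move_idx c b i) else 0%N.
Proof.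
move=> sc; rewrite box_arrayE; case: in_boxP => // ni.
case: ifP => // /forallP ic; exfalso; apply: ni => l.
by rewrite -sc positions_lt_size.
Qed.

Lemma arrays_with_size b A : arrays_with n N b A -> forall l, size (b l) = n l.
Proof. by move=> [_ <-] l; rewrite ffunE size_mkseq. Qed.

Section Fixed.
Variables (b c : {ffun 'I_d -> seq nat}) (A : array d).
Hypothesis bc : forall l, nonzeros (b l) = nonzeros (c l).
Hypothesis size_c : forall l, size (c l) = n l.
Hypothesis Ab : arrays_with n N b A.

Let cb l : nonzeros (c l) = nonzeros (b l).
Proof. by rewrite bc. Qed.

Let A' := move_array n b c A.

Let A'_on i : A' i != 0%N -> on_positions c i.
Proof. by rewrite move_arrayE//; case: ifP. Qed.

Let A'E i : on_positions c i -> A' i = A (move_idx c b i).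
Proof. by rewrite move_arrayE// => ->. Qed.

(** [move_idx c b] carries a chain in the support of [A'] to a chain with the same weight for
    [A]. *)
Lemma move_array_last_passage : (last_passage A' <= N)%N.
Proof.
have [[_ gA] _] := Ab; apply: last_passage_le_chain => s ss A's.
have onc i : i \in s -> on_positions c i by move=> /A's/A'_on.
rewrite big_seq (eq_bigr (fun i => A (move_idx c b i))); last first.
  by move=> i /onc/A'E.
rewrite -big_seq -(big_map (move_idx c b) xpredT (fun i => A i)).
apply: leq_trans gA; apply: chain_weight_le.
have /sub_in_sorted : {in on_positions c &, subrel (@idx_lt d)
    (fun i j => idx_lt (move_idx c b i) (move_idx c b j))}.
  by move=> i j ic jc; exact: move_idx_lt.
by move=> /(_ s); rewrite sorted_map; apply=> //; apply/allP.
Qed.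

Lemma move_array_finsupp :
  perm_eq [seq move_idx c b i | i <- finsupp A'] (finsupp A).
Proof.
apply: uniq_perm; rewrite ?fset_uniq//.
  rewrite map_inj_in_uniq ?fset_uniq// => i j; rewrite !mem_finsupp.
  move=> /A'_on ic /A'_on jc /(congr1 (move_idx b c)).
  by rewrite !move_idxK.
move=> i; apply/mapP/idP => [[j + ->]|].
  by rewrite !mem_finsupp => /[dup] /A'_on/A'E ->.
rewrite mem_finsupp => Ai; have ib := arrays_with_on Ab Ai.
exists (move_idx b c i); last by rewrite move_idxK.
by rewrite mem_finsupp A'E ?move_idxK// move_idx_on.
Qed.

(** On a zero position of [c] the slice misses the support. Otherwise the slice corresponds to the
    repositioned slice of [A], whose sum is the same entry seen in [b]. *)
Lemma move_array_slice_sum l j : (j < n l)%N -> slice_sum A' l j = nth 0%N (c l) j.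
Proof.
move=> jn; have [jc|] := boolP (j \in positions (c l)); last first.
  move=> jc; move: (jc); rewrite mem_positions negbK => /eqP ->.
  rewrite /slice_sum big_seq_cond big1// => i /andP[].
  rewrite mem_finsupp => /A'_on/forallP/(_ l) + /eqP ij.
  by rewrite ij (negPf jc).
have kb := reposition_in (cb l) jc.
have bE k : (k < n l)%N -> nth 0%N (b l) k = slice_sum A l k.
  by move=> kn; have [_ <-] := Ab; rewrite ffunE nth_mkseq.
rewrite -(reposition_nth (cb l) jc) bE; last first.
  by rewrite -(arrays_with_size Ab) positions_lt_size.
rewrite /slice_sum -(perm_big _ move_array_finsupp) big_map.
rewrite big_seq_cond [RHS]big_seq_cond; apply: eq_big => [i|i /andP[]]; last first.
  by rewrite mem_finsupp => /A'_on/A'E.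
apply: andb_id2l; rewrite mem_finsupp => /A'_on/forallP/(_ l) ic.
rewrite ffunE; apply/eqP/eqP => [->//|/(congr1 (reposition (b l) (c l)))].
by rewrite !repositionK.
Qed.

Lemma move_array_with : arrays_with n N c A'.
Proof.
split; first split=> [i|]; last 1 first.
- apply/ffunP => l; rewrite ffunE; apply: (@eq_from_nth _ 0%N).
    by rewrite size_mkseq size_c.
  by move=> j; rewrite size_mkseq => jn; rewrite nth_mkseq// move_array_slice_sum.
- by rewrite box_arrayE; case: in_boxP.
- exact: move_array_last_passage.
Qed.

Lemma move_arrayK : move_array n c b A' = A.
Proof.
apply/fsfunP => i; rewrite move_arrayE; last exact: arrays_with_size Ab.
case: ifP => [ib|/negbT nib].
  by rewrite A'E ?move_idxK// move_idx_on.
by apply/esym/eqP; apply: contraNT nib => /(arrays_with_on Ab).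
Qed.

End Fixed.

(** Moving from [b] to [c] is onto, since each array for [c] is the image of its own pull-back.
    Exchanging [b] and [c] gives equality of the counts. *)
Lemma leq_card_arrays_with b c :
  (forall l, nonzeros (b l) = nonzeros (c l)) -> (forall l, size (b l) = n l) ->
  (#|` fset_set (arrays_with n N c)| <= #|` fset_set (arrays_with n N b)|)%N.
Proof.
move=> bc sb.
apply: leq_trans (leq_imfset_card imfset_key (move_array n b c)
  (mem (fset_set (arrays_with n N b)))).
apply: fsubset_leq_card; apply/fsubsetP => A.
rewrite in_fset_set; last exact: finite_arrays_with.
rewrite inE => Ac; apply/imfsetP; exists (move_array n c b A) => /=; last first.
  by rewrite move_arrayK// => l; rewrite bc.
rewrite in_fset_set; last exact: finite_arrays_with.
by rewrite inE; apply: move_array_with => // l; rewrite bc.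
Qed.

End MoveArray.

(** The padded [alpha] is one family with the nonzero entries of [beta], and [alpha l] fits into
    length [n l], so the two counts bound each other. *)
Lemma mcoefE (d : nat) (n : 'I_d -> nat) (N : nat)
    (beta alpha : {ffun 'I_d -> seq nat}) :
  (forall l, nonzeros (beta l) = alpha l) -> (forall l, size (beta l) = n l) ->
  mcoef n N alpha = #|` fset_set (arrays_with n N beta)|.
Proof.
move=> ba sb.
have ca l : is_composition (alpha l).
  by rewrite -ba; apply/allP => x; rewrite mem_filter /= lt0n => /andP[].
have sa l : (size (alpha l) <= n l)%N by rewrite -ba size_filter -sb count_size.
have pE l : nonzeros (pad n alpha l) = nonzeros (beta l).
  by rewrite ffunE nonzeros_cat_nseq0.
rewrite /mcoef packed_arraysE//; apply/eqP; rewrite eqn_leq.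
apply/andP; split; apply: leq_card_arrays_with => // l.
by rewrite ffunE size_cat size_nseq subnKC.
Qed.

(** * Monomial quasisymmetric functions as sums over sequences of exponents *)

(* Meant for [size t = size a]: the entries outside [t] are then the default [0]
   of [nth]. *)
Definition spread (a : seq nat) (n : nat) (t : seq nat) : seq nat :=
  mkseq (fun j => nth 0%N a (index j t)) n.

Lemma positions_spread (a : seq nat) (n : nat) (t : seq nat) :
  is_composition a -> size t = size a -> sorted ltn t -> all (gtn n) t ->
  positions (spread a n t) = t.
Proof.
move=> /allP ca st ss /allP tn.
apply: (irr_sorted_eq ltn_trans ltnn) => //; first exact: positions_sorted.
move=> j; rewrite mem_positions; have [jn|nj] := ltnP j n; last first.
  rewrite nth_default ?size_mkseq//=; apply/esym/negbTE.
  by apply: contraL nj => /tn; rewrite -ltnNge.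
rewrite nth_mkseq//; apply/idP/idP.
  by apply: contraNT => jt; rewrite nth_default// -st memNindex.
by move=> jt; rewrite -lt0n; apply: ca; rewrite mem_nth// -st index_mem.
Qed.

Lemma nonzeros_spread (a : seq nat) (n : nat) (t : seq nat) :
  is_composition a -> size t = size a -> sorted ltn t -> all (gtn n) t ->
  nonzeros (spread a n t) = a.
Proof.
move=> ca st ss tn; rewrite -map_positions positions_spread//.
apply: (@eq_from_nth _ 0%N) => [|j]; rewrite size_map// => jt.
have ut : uniq t by exact: sorted_uniq ltn_trans ltnn _ ss.
rewrite (nth_map 0%N)// nth_mkseq ?index_uniq//.
by apply: (allP tn); rewrite mem_nth.
Qed.

Lemma spread_positions (b : seq nat) :
  spread (nonzeros b) (size b) (positions b) = b.
Proof.
apply: (@eq_from_nth _ 0%N) => [|j]; rewrite size_mkseq// => jb.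
rewrite nth_mkseq// -map_positions.
have [jp|jp] := boolP (j \in positions b).
  by rewrite (nth_map 0%N) ?index_mem// nth_index.
rewrite nth_default ?size_map ?memNindex//.
by move: jp; rewrite mem_positions negbK => /eqP.
Qed.

Lemma slice_monomial_positions (R : comNzRingType) (y : nat -> R) (b : seq nat) :
  slice_monomial y b = \prod_(j <- positions b) y j ^+ nth 0%N b j.
Proof.
rewrite /slice_monomial big_filter [RHS]big_mkcond /=.
rewrite -(big_mkord xpredT (fun j => y j ^+ nth 0%N b j)) /index_iota subn0.
by apply: eq_bigr => j _; case: eqP => [->|].
Qed.

(** Written to be convertible with the summation condition of [monomial_qsym]. *)
Definition increasing (k n : nat) (f : {ffun 'I_k -> 'I_n}) : bool :=
  [forall p : 'I_k, forall q : 'I_k, (p < q)%N ==> (f p < f q)%N].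

Definition values (k n : nat) (f : {ffun 'I_k -> 'I_n}) : seq nat :=
  [seq val (f p) | p <- enum 'I_k].

Lemma nth_values (k n : nat) (f : {ffun 'I_k -> 'I_n}) (p : 'I_k) :
  nth 0%N (values f) p = f p.
Proof. by rewrite (nth_map p) ?size_enum_ord// nth_ord_enum. Qed.

Lemma size_values (k n : nat) (f : {ffun 'I_k -> 'I_n}) : size (values f) = k.
Proof. by rewrite size_map size_enum_ord. Qed.

Lemma values_lt (k n : nat) (f : {ffun 'I_k -> 'I_n}) : all (gtn n) (values f).
Proof. by apply/allP => j /mapP[p _ ->] /=. Qed.

Lemma values_sorted (k n : nat) (f : {ffun 'I_k -> 'I_n}) :
  increasing f -> sorted ltn (values f).
Proof.
move=> /forallP incf; rewrite sorted_map.
have /sub_sorted : subrel (relpre val ltn) (relpre (fun p => val (f p)) ltn).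
  by move=> p q /= pq; move/forallP/(_ q)/implyP: (incf p); apply.
by apply; rewrite -sorted_map val_enum_ord iota_ltn_sorted.
Qed.

Lemma values_inj (k n : nat) : injective (@values k n).
Proof.
move=> f g E; apply/ffunP => p; apply: val_inj.
by rewrite /= -!nth_values E.
Qed.

Lemma values_exists (k n : nat) (t : seq nat) : size t = k -> all (gtn n) t ->
  sorted ltn t -> exists2 f : {ffun 'I_k -> 'I_n}, increasing f & values f = t.
Proof.
move=> st /allP tn ss.
have H (p : 'I_k) : (nth 0 t p < n)%N by apply: tn; rewrite mem_nth// st.
exists [ffun p => Ordinal (H p)].
  apply/forallP => p; apply/forallP => q; apply/implyP => pq; rewrite !ffunE /=.
  by apply: (sorted_ltn_nth ltn_trans) pq => //; rewrite inE st.
apply: (@eq_from_nth _ 0%N); first by rewrite size_values st.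
move=> j; rewrite size_values => jk.
by rewrite (nth_values _ (Ordinal jk)) ffunE.
Qed.

Definition expansions (a : seq nat) (n : nat) : seq (seq nat) :=
  [seq spread a n (values f) |
     f : {ffun 'I_(size a) -> 'I_n} <- enum (@increasing (size a) n)].

Lemma expansions_uniq (a : seq nat) (n : nat) :
  is_composition a -> uniq (expansions a n).
Proof.
move=> ca; rewrite map_inj_in_uniq ?enum_uniq// => f g.
rewrite !mem_enum => /values_sorted sf /values_sorted sg /(congr1 positions).
rewrite !positions_spread ?values_lt ?size_values//; exact: values_inj.
Qed.

(** Any [b] is the spread of its nonzero entries along its own positions, and these come from an
    increasing function. *)
Lemma mem_expansions (a : seq nat) (n : nat) (b : seq nat) :
  is_composition a ->
  (b \in expansions a n) = (size b == n) && (nonzeros b == a).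
Proof.
move=> ca; apply/mapP/andP => [[f + ->]|[/eqP <- /eqP <-]].
  rewrite mem_enum => /values_sorted sf.
  by rewrite size_mkseq nonzeros_spread ?values_lt ?size_values// !eqxx.
have [|||f incf E] := @values_exists (size (nonzeros b)) (size b) (positions b).
- by rewrite size_positions.
- by apply/allP => j; exact: positions_lt_size.
- exact: positions_sorted.
by exists f; rewrite ?mem_enum// E spread_positions.
Qed.

Lemma monomial_qsymE (R : comNzRingType) (a : seq nat) (n : nat) (y : nat -> R) :
  is_composition a ->
  monomial_qsym a n y = \sum_(b <- expansions a n) slice_monomial y b.
Proof.
move=> ca; rewrite big_map big_enum; apply: eq_bigr => f incf.
have sf := values_sorted incf.
rewrite slice_monomial_positions positions_spread ?values_lt ?size_values//.
rewrite big_map big_enum; apply: eq_bigr => p _.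
have ut : uniq (values f) by exact: sorted_uniq ltn_trans ltnn _ sf.
by rewrite nth_mkseq//= -nth_values index_uniq ?size_values.
Qed.

(** * Summation over families of compositions *)

(** Distributivity when the index list depends on the factor. All lists are put into one finite set
    [U], so that choices become functions between finite types. *)
Lemma prod_sum_seq (R : comNzRingType) (I : finType) (T : choiceType)
    (X : I -> seq T) : (forall i, uniq (X i)) ->
  exists B : seq {ffun I -> T},
    [/\ uniq B, forall beta, (beta \in B) = [forall i, beta i \in X i] &
        forall F : I -> T -> R,
          \prod_i \sum_(b <- X i) F i b = \sum_(beta <- B) \prod_i F i (beta i)].
Proof.
move=> uX; pose U : {fset T} := [fset x in flatten [seq X i | i <- enum I]]%fset.
have XU i x : x \in X i -> x \in U.
  by move=> xi; rewrite inE; apply/flatten_mapP; exists i; rewrite ?mem_enum.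
pose Q i := [pred u : U | val u \in X i].
pose B := [seq ([ffun i => val (g i)] : {ffun I -> T}) |
             g : {ffun I -> U} <- enum (family Q)].
exists B; split.
- rewrite map_inj_uniq ?enum_uniq// => g h E; apply/ffunP => i; apply: val_inj.
  by have := congr1 (fun f : {ffun I -> T} => f i) E; rewrite !ffunE.
- move=> beta; apply/mapP/forallP => [[g + ->] i|bX].
    by rewrite mem_enum ffunE => /familyP/(_ i).
  exists [ffun i => [` XU i _ (bX i)]%fset]; last by apply/ffunP => i; rewrite !ffunE.
  by rewrite mem_enum; apply/familyP => i; rewrite ffunE inE /=; exact: bX.
move=> F; rewrite big_map big_enum /=.
transitivity (\prod_i \sum_(u : U | Q i u) F i (val u)).
  apply: eq_bigr => i _; rewrite -(big_seq_fsetE _ _ (mem (X i))) -[RHS]big_filter.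
  apply: perm_big; apply: uniq_perm; rewrite ?filter_uniq ?fset_uniq// => x.
  by rewrite mem_filter; apply/esym/andb_idr => /XU.
rewrite bigA_distr_big_dep; apply: eq_bigr => g _.
by apply: eq_bigr => i _; rewrite ffunE.
Qed.

Lemma sumn_nonzeros (s : seq nat) : sumn (nonzeros s) = sumn s.
Proof. by elim: s => //= x s IH; case: eqP => [->|_] /=; rewrite IH. Qed.

Lemma sumn_slice_sums (d : nat) (n : 'I_d -> nat) (A : array d) (l : 'I_d) :
  (forall i, A i != 0%N -> in_box n i) ->
  sumn (slice_sums n A l) = (\sum_(i <- finsupp A) A i)%N.
Proof.
move=> sA; rewrite sumnE big_map -{1}[n l]subn0 -/(index_iota 0 (n l)) big_mkord.
rewrite /slice_sum (exchange_big_dep xpredT)//=; apply: eq_big_seq => i.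
by rewrite mem_finsupp => /sA/(_ l) il; rewrite (big_pred1 (Ordinal il)).
Qed.

Definition slice_compositions (d : nat) (n : 'I_d -> nat) (A : array d) :
    {ffun 'I_d -> seq nat} := [ffun l => nonzeros (slice_sums n A l)].

(** The sizes agree because in every direction the slices add up to the total of all entries. *)
Lemma slice_compositions_family (d : nat) (n : 'I_d -> nat) (N : nat) (A : array d) :
  arrays_le n N A -> composition_families d (slice_compositions n A).
Proof.
move=> [sA _]; split=> [l|k l]; rewrite !ffunE.
  by apply/allP => x; rewrite mem_filter /= lt0n => /andP[].
by rewrite !sumn_nonzeros !sumn_slice_sums.
Qed.

(** Both sides are sums over the families [beta] whose nonzero entries are [alpha]; by [mcoefE] each
    of them is the slice family of the same number of arrays. *)
Lemma sum_slice_weight (d : nat) (n : 'I_d -> nat) (N : nat)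
    (alpha : {ffun 'I_d -> seq nat}) :
  (forall l, is_composition (alpha l)) ->
  \sum_(A <- fset_set (arrays_le n N) | slice_compositions n A == alpha)
     slice_weight (slice_family n A) =
  (mcoef n N alpha)%:R *
    \prod_(l < d) monomial_qsym (alpha l) (n l) (xvar l) :> polyring d.
Proof.
move=> ca; under [in RHS]eq_bigr => l _ do rewrite monomial_qsymE//.
have [B [uB memB ->]] := @prod_sum_seq (polyring d) 'I_d _
  (fun l => expansions (alpha l) (n l)) (fun l => expansions_uniq (n l) (ca l)).
have memBA A : (slice_family n A \in B) = (slice_compositions n A == alpha).
  rewrite memB; apply/forallP/eqP => [H|E l].
    by apply/ffunP => l; have := H l; rewrite mem_expansions// !ffunE => /andP[_ /eqP].
  by rewrite mem_expansions// -E !ffunE size_mkseq !eqxx.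
rewrite big_distrr /=.
(* An array with compositions [alpha] matches exactly one [beta] in the duplicate-free list [B], any
   other array none. *)
transitivity (\sum_(beta <- B)
    \sum_(A <- fset_set (arrays_le n N) | slice_family n A == beta)
      slice_weight (slice_family n A)).
  rewrite (exchange_big_dep xpredT)//= big_mkcond; apply: eq_bigr => A _.
  rewrite -memBA; case: ifPn => AB.
    under eq_bigl do rewrite eq_sym.
    by rewrite -big_filter (filter_pred1_uniq uB AB) big_seq1.
  by rewrite big1_seq// => beta /andP[/eqP <-]; rewrite (negPf AB).
apply: eq_big_seq => beta; rewrite memB => /forallP H.
have {}H l : size (beta l) = n l /\ nonzeros (beta l) = alpha l.
  by have := H l; rewrite mem_expansions// => /andP[/eqP ? /eqP].
rewrite (@mcoefE _ _ _ beta) => [|l|l]; [|by have [] := H l|by have [] := H l].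
rewrite (eq_bigr (fun=> slice_weight beta)) => [|A /eqP ->//].
rewrite big_fset_condE big_const_seq count_predT iter_addr_0 mulr_natl.
congr (_ *+ size _); congr enum_fset; apply/fsetP => A.
rewrite in_fset_set; last exact: finite_arrays_with.
rewrite in_fset inE /= [X in X && _]in_fset_set; last exact: finite_arrays_le.
by apply/andP/idP; rewrite !inE => -[AM /eqP AE].
Qed.

Theorem theorem6p12 (d : nat) (n : 'I_d -> nat) (N : nat)
    (n_gt0 : forall l, (0 < n l)%N) (N_gt0 : (0 < N)%N) :
  Fpoly n N =
  \sum_(alpha \in composition_families d)
    (mcoef n N alpha)%:R *
    \prod_(l < d) monomial_qsym (alpha l) (n l) (xvar l).
Proof.
have finL := finite_arrays_le n N; set L := fset_set (arrays_le n N).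
have inL A : A \in L -> arrays_le n N A by rewrite in_fset_set// inE.
(* The finitely many families that occur; the sum on the right reduces to them. *)
pose C := [fset slice_compositions n A | A in L]%fset.
rewrite Fpoly_arrays fsbig_finite// (partition_big_imfset _ (slice_compositions n)).
rewrite (fsbigE C) ?fset_uniq//=; first last.
(* A packed array counted by [mcoef n N alpha] has [alpha] as its nonzero slice sums, which would
   put [alpha] in [C]. *)
- move=> alpha [ca _] alphaC; suff -> : mcoef n N alpha = 0%N by rewrite mul0r.
  apply/eqP; rewrite cardfs_eq0; apply: contraNT alphaC => /fset0Pn[A].
  rewrite in_fset_set; last exact: finite_packed_arrays.
  rewrite packed_arraysE// inE => -[MA EA]; apply/imfsetP; exists A.
    by rewrite in_fset_set// inE.
  apply/ffunP => l; rewrite ffunE.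
  have := congr1 (fun f : {ffun 'I_d -> seq nat} => f l) EA; rewrite !ffunE => ->.
  by rewrite nonzeros_cat_nseq0.
- by move=> alpha /= /imfsetP[A /inL AL ->]; exact: slice_compositions_family AL.
(* Membership in [composition_families] remains as a guard on the right; every element of [C]
   satisfies it. *)
rewrite [RHS]big_mkcond; apply: eq_big_seq => alpha /imfsetP[A /inL AL ->].
have CA := slice_compositions_family AL.
by rewrite mem_set//; apply: sum_slice_weight; have [] := CA.
Qed.
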